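(* Let $f$ be an endomorphism of the monoid $\mathcal P_{\mathrm{fin},0}(\mathbb N)$. The following are equivalent: (a) $f$ is injective and $f(\{0,1\}) = \{0,1\}$. (b) $f$ is surjective. (c) $f$ is an automorphism.
   Context: $\mathbb N$ denotes the set of non-negative integers. $\mathcal P_{\mathrm{fin},0}(\mathbb N)$ is the set of all finite subsets of $\mathbb N$ containing $0$, made into a commutative monoid by the sumset operation $X + Y := \{x + y : x \in X,\ y \in Y\}$; its neutral element is $\{0\}$. An endomorphism is a monoid homomorphism from the monoid to itself; an automorphism is a bijective endomorphism. *)

(* Defs.v *)
From HB Require Import structures.
From mathcomp Require Import all_boot all_algebra finmap.
Set Implicit Arguments.
Unset Strict Implicit.
Unset Printing Implicit Defensive.

Local Open Scope fset_scope.

Definition sumset (X Y : {fset nat}) : {fset nat} :=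
  [fset (x + y)%N | x in X, y in Y].

Lemma sumsetP (X Y : {fset nat}) (n : nat) :
  reflect (exists x y, [/\ x \in X, y \in Y & n = (x + y)%N])
          (n \in sumset X Y).
Proof.
apply: (iffP (imfset2P _ _ _ _ _)).
  by move=> [x /= xX [y /= yY ->]]; exists x, y.
by move=> [x [y [xX yY ->]]]; exists x => //; exists y.
Qed.

Lemma sumsetC : commutative sumset.
Proof.
move=> X Y; apply/fsetP => n; apply/sumsetP/sumsetP => -[x [y [xX yY ->]]];
  by exists y, x; split; rewrite // addnC.
Qed.

Lemma sumsetA : associative sumset.
Proof.
move=> X Y Z; apply/fsetP => n; apply/sumsetP/sumsetP.
- move=> [x [_ [xX /sumsetP[y [z [yY zZ ->]]] ->]]].
  exists (x + y)%N, z; split; rewrite ?addnA //.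
  by apply/sumsetP; exists x, y.
- move=> [_ [z [/sumsetP[x [y [xX yY ->]]] zZ ->]]].
  exists x, (y + z)%N; split; rewrite ?addnA //.
  by apply/sumsetP; exists y, z.
Qed.

Lemma sum0set : left_id [fset 0%N] sumset.
Proof.
move=> X; apply/fsetP => n; apply/sumsetP/idP.
  by move=> [x [y [/fset1P-> yX ->]]].
by move=> nX; exists 0%N, n; split; rewrite ?inE.
Qed.

Record pfin0 : Type := Pfin0 {
  pfin0_val :> {fset nat};
  pfin0P : 0%N \in pfin0_val
}.

HB.instance Definition _ := [isSub for pfin0_val].
HB.instance Definition _ := [Choice of pfin0 by <:].

Lemma sumset_mem0 (X Y : pfin0) : 0%N \in sumset X Y.
Proof. by apply/sumsetP; exists 0%N, 0%N; split; rewrite ?pfin0P. Qed.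

Definition pfin0_zero : pfin0 := Pfin0 (fset11 0%N).
Definition pfin0_add (X Y : pfin0) : pfin0 := Pfin0 (sumset_mem0 X Y).

Lemma pfin0_addA : associative pfin0_add.
Proof. by move=> X Y Z; apply/val_inj/sumsetA. Qed.

Lemma pfin0_addC : commutative pfin0_add.
Proof. by move=> X Y; apply/val_inj/sumsetC. Qed.

Lemma pfin0_add0 : left_id pfin0_zero pfin0_add.
Proof. by move=> X; apply/val_inj/sum0set. Qed.

(* On an [nmodType], [{additive pfin0 -> pfin0}] means a map preserving both
   the sumset operation and its neutral element {0}: a monoid endomorphism. *)
HB.instance Definition _ :=
  GRing.isNmodule.Build pfin0 pfin0_addA pfin0_addC pfin0_add0.

Definition pfin0_01 : pfin0 := Pfin0 (fset21 0%N 1%N).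

(* Main.v *)
(** The maximum is an additive map to the natural numbers. With [I = {0,1}] and
    [m = max X], one has [X + m I = (m + m) I], since [X] contains [0] and [m].
    Applying [f] and taking maxima gives [max (f X) = max (f I) * max X]. If [f]
    fixes [I], or is surjective (so that [I] is attained), then [f] preserves
    maxima; as only finitely many sets have a given bound on their maximum,
    injectivity and surjectivity then coincide. *)
Require Import Defs.
From HB Require Import structures.
From mathcomp Require Import all_boot all_algebra finmap.

Set Implicit Arguments.
Unset Strict Implicit.
Unset Printing Implicit Defensive.

Import GRing.Theory.

Definition pmax (X : pfin0) : nat := \max_(x <- pfin0_val X) x.

Lemma pmax_geq (X : pfin0) (x : nat) : x \in pfin0_val X -> x <= pmax X.
Proof. by move=> xX; apply: leq_bigmax_seq. Qed.

Lemma pmax_leqP (X : pfin0) (n : nat) :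
  reflect (forall x, x \in pfin0_val X -> x <= n) (pmax X <= n).
Proof.
apply: (iffP idP) => [le_n x /pmax_geq le_x|le_n]; first exact: leq_trans le_n.
by apply/bigmax_leqP_seq => x xX _; apply: le_n.
Qed.

Lemma pmax_mem (X : pfin0) : pmax X \in pfin0_val X.
Proof.
suff: forall s : seq nat, 0 \in s -> \max_(x <- s) x \in s.
  by apply; apply: pfin0P.
(* The empty maximum is 0, so for an arbitrary list the induction has to allow 0 as an extra value;
   the hypothesis that 0 lies in [s] removes it afterwards. *)
have max0 s : \max_(x <- s) x \in 0 :: s.
  elim: s => [|a s IHs]; first by rewrite big_nil inE.
  rewrite big_cons /maxn; case: ifP => _; last by rewrite !inE eqxx orbT.
  by move: IHs; rewrite !inE => /orP[->|->]; rewrite ?orbT.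
by move=> s s0; have := max0 s; rewrite inE => /predU1P[->|].
Qed.

Lemma mem_pfin0_add (X Y : pfin0) (x y : nat) :
  x \in pfin0_val X -> y \in pfin0_val Y -> x + y \in pfin0_val (X + Y)%R.
Proof. by move=> xX yY; apply/sumsetP; exists x, y. Qed.

Lemma pmax0 : pmax 0%R = 0.
Proof. by apply/eqP; rewrite -leqn0; apply/pmax_leqP => x /fset1P->. Qed.

Lemma pmaxD (X Y : pfin0) : pmax (X + Y)%R = pmax X + pmax Y.
Proof.
apply/eqP; rewrite eqn_leq [X in _ && X]pmax_geq ?andbT; last first.
  by apply: mem_pfin0_add; apply: pmax_mem.
apply/pmax_leqP => _ /sumsetP[x [y [xX yY ->]]].
by rewrite leq_add ?pmax_geq.
Qed.

Lemma pmaxMn (X : pfin0) (n : nat) : pmax (X *+ n)%R = n * pmax X.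
Proof. by elim: n => [|n IHn]; rewrite ?pmax0 // mulrS pmaxD IHn mulSn. Qed.

Lemma mem_01Mn (n x : nat) : (x \in pfin0_val (pfin0_01 *+ n)%R) = (x <= n).
Proof.
elim: n x => [|n IHn] x; first by rewrite leqn0 inE.
rewrite mulrS; apply/sumsetP/idP => [[y [z [y01 zn ->]]]|].
  by move: y01 zn; rewrite IHn !inE => /orP[]/eqP-> // /leqW.
case: x => [_|x lexn]; first by exists 0, 0; rewrite IHn !inE.
by exists 1, x; rewrite IHn !inE.
Qed.

Lemma pmax_01 : pmax pfin0_01 = 1.
Proof.
apply/eqP; rewrite eqn_leq pmax_geq ?inE // andbT.
by apply/pmax_leqP => x; rewrite !inE => /orP[]/eqP->.
Qed.

Lemma add_01Mn_pmax (X : pfin0) :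
  (X + pfin0_01 *+ pmax X = pfin0_01 *+ (pmax X + pmax X))%R.
Proof.
apply/val_inj/fsetP => z; rewrite [RHS]mem_01Mn.
apply/sumsetP/idP => [[x [y [xX]]]|lez].
  by rewrite mem_01Mn => ley ->; rewrite leq_add // pmax_geq.
(* The translates of [0, m] by the elements 0 and m of [X] already cover [0, 2m]. *)
have [lezm|/ltnW lemz] := leqP z (pmax X).
  by exists 0, z; rewrite mem_01Mn pfin0P.
by exists (pmax X), (z - pmax X); rewrite mem_01Mn pmax_mem leq_subLR subnKC.
Qed.

Lemma pmax_endo (f : {additive pfin0 -> pfin0}) (X : pfin0) :
  pmax (f X) = pmax X * pmax (f pfin0_01).
Proof.
(* With c the maximum of [f pfin0_01] and m that of [X], this reads max (f X) + m c = m c + m c, and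
   m c cancels. *)
have := congr1 (fun Y => pmax (f Y)) (add_01Mn_pmax X).
by rewrite /= raddfD !raddfMn pmaxD !pmaxMn mulnDl => /addIn.
Qed.

(** Both 0 and the maximum always belong to the set. This lets [f pfin0_01] be identified from its
    maximum alone. *)
Lemma pmax_eq1 (X : pfin0) : pmax X = 1 -> X = pfin0_01.
Proof.
move=> maxX; apply/val_inj/fsetP => x; rewrite !inE.
apply/idP/orP => [/pmax_geq|[]/eqP->]; last 2 first.
- exact: pfin0P.
- by rewrite -maxX pmax_mem.
by rewrite maxX; case: x => [|[|]] //; [left | right].
Qed.

(** The subsets of [0, n], where [insub] discards those that miss 0. *)
Definition pmax_bounded (n : nat) : seq pfin0 :=
  pmap insub (fpowerset (pfin0_val (pfin0_01 *+ n)%R)).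

Lemma pmax_bounded_uniq (n : nat) : uniq (pmax_bounded n).
Proof. exact/pmap_sub_uniq/fset_uniq. Qed.

Lemma mem_pmax_bounded (n : nat) (X : pfin0) :
  (X \in pmax_bounded n) = (pmax X <= n).
Proof.
rewrite mem_pmap_sub fpowersetE.
by apply/fsubsetP/pmax_leqP => sub x /sub; rewrite mem_01Mn.
Qed.

(** Such a map permutes each of the finite lists [pmax_bounded n]. Additivity is not assumed, so
    that a mere section of an endomorphism qualifies as [g]. *)
Lemma inj_pmax_surj (g : pfin0 -> pfin0) :
  injective g -> (forall X, pmax (g X) = pmax X) ->
  forall Y, exists X, g X = Y.
Proof.
move=> injg maxg Y; pose s := pmax_bounded (pmax Y).
have sub : {subset map g s <= s}.
  by move=> _ /mapP[X Xs ->]; rewrite mem_pmax_bounded maxg -mem_pmax_bounded.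
have ugs : uniq (map g s) by rewrite map_inj_uniq ?pmax_bounded_uniq.
have [_ eqs] := uniq_min_size ugs sub (eq_leq (esym (size_map g s))).
have : Y \in map g s by rewrite eqs mem_pmax_bounded.
by case/mapP => X _ ->; exists X.
Qed.

(** If [f X] is {0,1}, then 1 is the product of the maxima of [X] and [f pfin0_01], so both are
    1. *)
Lemma surj_fix_01 (f : {additive pfin0 -> pfin0}) :
  (forall Y, exists X, f X = Y) -> f pfin0_01 = pfin0_01.
Proof.
move=> surj; have [X fX] := surj pfin0_01.
apply: pmax_eq1; apply/eqP; move/(congr1 pmax)/eqP: fX.
by rewrite pmax_endo pmax_01 muln_eq1 => /andP[].
Qed.

Lemma fix_01_pmax (f : {additive pfin0 -> pfin0}) :
  f pfin0_01 = pfin0_01 -> forall X, pmax (f X) = pmax X.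
Proof. by move=> f01 X; rewrite pmax_endo f01 pmax_01 muln1. Qed.

Theorem theorem2p5 (f : {additive pfin0 -> pfin0}) :
  [<-> injective f /\ f pfin0_01 = pfin0_01;
       forall Y : pfin0, exists X : pfin0, f X = Y;
       bijective f].
Proof.
tfae.
- by case=> injf /fix_01_pmax; apply: inj_pmax_surj.
- move=> surj; have maxf := fix_01_pmax (surj_fix_01 surj).
  have surjb Y : exists X, f X == Y by have [X <-] := surj Y; exists X.
  (* A chosen section [g] of [f] is injective and preserves maxima, hence is surjective by counting;
     a surjective section is a two-sided inverse. *)
  pose g Y := xchoose (surjb Y).
  have gK : cancel g f by move=> Y; apply/eqP/(xchooseP (surjb Y)).
  have maxg Y : pmax (g Y) = pmax Y by rewrite -maxf gK.
  exists g => // X.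
  by have [Y <-] := inj_pmax_surj (can_inj gK) maxg X; rewrite gK.
- move=> bijf; split; first exact: bij_inj.
  by apply: surj_fix_01 => Y; case: bijf => g _ gK; exists (g Y).
Qed.
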